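(* Let $p,q\ge 1$ be integers, let $C(1),\ldots,C(q)\in M_p$ be selfadjoint matrices and let $b_1,\ldots,b_q$ be real numbers. Suppose that $C(1),\ldots,C(q)$ are linearly independent (over $\mathbb{R}$) and that their (real) linear span contains strictly positive matrices. Then: (a) There exists $X\in M_p$ with $X\geq 0$ and $\operatorname{tr}(C(\iota)X)=b_\iota$ for all $\iota=1,\ldots,q$ if and only if $\sum_{\iota=1}^q b_\iota x_\iota\geq 0$ for all $x=(x_\iota)_{\iota=1}^q\in\mathbb{R}^q$ such that $\sum_{\iota=1}^q x_\iota C(\iota)\geq 0$, namely $$\inf_{x\in\mathbb{R}^q\,:\,\sum_\iota x_\iota C(\iota)\geq 0}\ \sum_{\iota=1}^q b_\iota x_\iota\ \geq 0.$$ (b) There exists $X\in M_p$ with $X>0$ and $\operatorname{tr}(C(\iota)X)=b_\iota$ for all $\iota=1,\ldots,q$ if and only if $\sum_{\iota=1}^q b_\iota x_\iota>0$ for all $x=(x_\iota)_{\iota=1}^q\in\mathbb{R}^q$, $x\neq 0$, such that $\sum_{\iota=1}^q x_\iota C(\iota)\geq 0$, namely, for any norm $\|\cdot\|$ on $\mathbb{R}^q$, $$\inf_{x\in\mathbb{R}^q\,:\,\sum_\iota x_\iota C(\iota)\geq 0,\ \|x\|=1}\ \sum_{\iota=1}^q b_\iota x_\iota\ >0.$$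
   Context: $M_p$ denotes the algebra of all $p\times p$ complex matrices and $\operatorname{tr}$ the (unnormalized) trace. For $Y\in M_p$, $Y\geq 0$ means that $Y$ is positive semidefinite (in particular selfadjoint), and $Y>0$ (''strictly positive'') means that $Y$ is positive definite. *)

(* Defs.v *)
From HB Require Import structures.
From mathcomp Require Import all_boot all_order all_algebra.
From mathcomp Require Import spectral complex.
From mathcomp Require Import boolp classical_sets reals ereal.

Set Implicit Arguments.
Unset Strict Implicit.
Unset Printing Implicit Defensive.

Import Order.TTheory GRing.Theory Num.Theory.
Local Open Scope ring_scope.
Local Open Scope complex_scope.
Local Open Scope sesquilinear_scope.

(* For [z : R[i]], [0 <= z] (resp. [0 < z]) means that z is real and
   nonnegative (resp. positive). *)
Definition psdmx (R : realType) (p : nat) (A : 'M[R[i]]_p) : Prop :=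
  A \is hermsymmx /\ forall v : 'cV[R[i]]_p, 0 <= (v ^t* *m A *m v) 0 0.

Definition posdefmx (R : realType) (p : nat) (A : 'M[R[i]]_p) : Prop :=
  A \is hermsymmx /\
  forall v : 'cV[R[i]]_p, v != 0 -> 0 < (v ^t* *m A *m v) 0 0.

Definition real_comb (R : realType) (p q : nat) (C : 'I_q -> 'M[R[i]]_p)
    (x : 'rV[R]_q) : 'M[R[i]]_p :=
  \sum_i (x 0 i)%:C *: C i.

(* Stated by hand because [free] needs a real [vectType] on ['M[R[i]]_p],
   whose canonical scalars are R[i]. *)
Definition real_independent (R : realType) (p q : nat)
    (C : 'I_q -> 'M[R[i]]_p) : Prop :=
  forall x : 'rV[R]_q, real_comb C x = 0 -> x = 0.

(* The axioms of the library factory [Lmodule_isNormed]; nonnegativity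
   follows from them. *)
Definition is_norm (R : realType) (q : nat) (N : 'rV[R]_q -> R) : Prop :=
  [/\ forall x y, N (x + y) <= N x + N y,
      forall (a : R) x, N (a *: x) = `|a| * N x
    & forall x, N x = 0 -> x = 0].

(* Main.v *)
Require Import Defs.
From HB Require Import structures.
From mathcomp Require Import all_boot all_order all_algebra.
From mathcomp Require Import spectral complex.
From mathcomp Require Import boolp classical_sets reals ereal.
From mathcomp Require Import topology normedtype derive.
From mathcomp Require Import ring lra.

(** Write [C(x)] for [real_comb C x], and let [L] send a Hermitian matrix [X]
    to the real vector of the [tr (C i X)], so that the pairing of [x] with
    [L X] is [tr (C(x) X)].

    The necessity of both conditions is the positivity of the trace pairing:
    diagonalizing one factor shows [tr (A X) >= 0] for [A, X >= 0]
    ([trace_psd_ge0]) and [tr (A X) > 0] for [A > 0] and [0 != X >= 0]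
    ([trace_posdef_gt0]).  In the strict case, linear independence is what
    makes [C(x)] nonzero for [x != 0].

    Sufficiency in (a) is conic duality: [b] has to lie in the image under [L]
    of the cone of positive semidefinite matrices.  The image of a closed cone
    can fail to be closed; here some [C(x0)] is positive definite, so
    [tr (C(x0) X)] is positive on the nonzero part of the cone and hence, by
    compactness of the unit sphere, dominates the norm of [X]
    ([conic_coercive]).  Therefore the distance from [b] to [L X] attains its
    minimum over the cone.  The first-order conditions say that the residual
    [r = L X - b] satisfies [tr (C(r) Z) >= 0] for all [Z >= 0], so that
    [C(r) >= 0], and that [r] pairs nonpositively with [L X]; the hypothesis
    on [b] applied to [r] then forces [r = 0] ([conic_farkas]).

    Sufficiency in (b) is reduced to (a).  Compactness in the [x] variable
    improves strict positivity to [d |x| <= b . x] whenever [C(x) >= 0]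
    ([strict_dual_margin]).  The margin leaves room to replace [b] by
    [b - e L(1)] with a small [e > 0]; a positive semidefinite solution [X]
    for this vector gives the positive definite solution [X + e 1] for [b].

    The same margin bounds the infimum over the unit sphere of an arbitrary
    norm, because every norm is at most a multiple of the sup norm
    ([seminorm_bounded]). *)

Set Implicit Arguments.
Unset Strict Implicit.
Unset Printing Implicit Defensive.

Import Order.TTheory GRing.Theory Num.Theory.
Import numFieldNormedType.Exports.
Local Open Scope classical_set_scope.
Local Open Scope ring_scope.
Local Open Scope complex_scope.

(** * Closed convex cones in real coordinate spaces *)

(** Expanding [x] on the standard basis bounds [N x] by the sup norm times the
    sum of the values of [N] on that basis. *)
Lemma seminorm_bounded (R : realType) n (N : 'rV[R]_n -> R) :
  (forall x y, N (x + y) <= N x + N y) ->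
  (forall a x, N (a *: x) = `|a| * N x) ->
  exists2 M, 0 < M & forall x, N x <= M * `|x|.
Proof.
move=> ND NZ.
have N0 : N 0 = 0 by rewrite -(scale0r 0) NZ normr0 mul0r.
have Nge0 x : 0 <= N x.
  have := ND x (- x); rewrite subrr N0 -scaleN1r NZ normrN1 mul1r.
  by rewrite -mulr2n pmulrn_lge0.
(* The summand 1 only serves to make the constant positive. *)
exists (1 + \sum_i N (delta_mx 0 i)).
  by rewrite ltr_pwDl// sumr_ge0.
move=> x; rewrite mulrDl mul1r ler_wpDl// mulr_suml.
have Nsum (s : seq 'I_n) (F : 'I_n -> 'rV[R]_n) :
    N (\sum_(i <- s) F i) <= \sum_(i <- s) N (F i).
  elim: s => [|i s IHs]; first by rewrite !big_nil N0.
  by rewrite !big_cons (le_trans (ND _ _)) ?lerD2l.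
rewrite {1}(row_sum_delta x); apply: (le_trans (Nsum _ _)).
apply: ler_sum => i _; rewrite NZ mulrC ler_wpM2l//.
rewrite [leRHS]/Num.norm /= mx_normrE; apply/bigmax_geP; right => /=.
by exists (0, i).
Qed.

Lemma scalar_continuous (R : realType) n (f : 'rV[R]_n -> R) :
  scalar f -> continuous f.
Proof.
move=> fL.
pose fl := GRing.isLinear.Build _ _ _ _ f fL.
pose F : {scalar 'rV[R]_n} := HB.pack f fl.
have -> : f = fun u : 'rV[R]_n => \sum_i u 0 i * f (delta_mx 0 i).
  apply/funext => u; rewrite {1}(row_sum_delta u) -[f _]/(F _) linear_sum.
  by apply: eq_bigr => i _; rewrite linearZ.
apply: continuous_big; first exact: add_continuous.
by move=> i _ x; apply: (cvgMr_tmp (F := nbhs x)); exact: coord_continuous.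
Qed.

(** [f] attains a positive minimum on the compact set of unit vectors of [K];
    homogeneity spreads this bound over the whole cone. *)
Lemma conic_coercive (R : realType) n (K : set 'rV[R]_n) (f : 'rV[R]_n -> R) :
  closed K -> (forall a u, 0 < a -> K u -> K (a *: u)) -> scalar f ->
  (forall u, K u -> u != 0 -> 0 < f u) ->
  exists2 d, 0 < d & forall u, K u -> d * `|u| <= f u.
Proof.
move=> Kcl Kcone fL fpos.
pose fl := GRing.isLinear.Build _ _ _ _ f fL.
pose F : {scalar 'rV[R]_n} := HB.pack f fl.
pose S := K `&` [set u : 'rV[R]_n | `|u| = 1].
have onS u : K u -> u != 0 -> S (`|u|^-1 *: u).
  move=> Ku u0; split; first by apply: Kcone => //; rewrite invr_gt0 normr_gt0.
  by rewrite /= normrZ normfV normr_id mulVf// normr_eq0.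
have f0 : f 0 = 0 by exact: (linear0 F).
have [[u1 Su1]|noS] := pselect (S !=set0); last first.
  exists 1 => // u Ku; have [->|u0] := eqVneq u 0; last first.
    by case: noS; eexists; exact: onS u0.
  by rewrite normr0 mulr0 f0.
have Scpt : compact S.
  apply: bounded_closed_compact.
    by exists 1; split => // t t1 u [_ /= ->]; exact: ltW.
  apply: closedI => //.
  apply: (@preimage_closed _ _ (fun u : 'rV[R]_n => `|u|) [set 1]).
    by move=> u _; exact: norm_continuous.
  exact: closed_eq.
have [c cS cmin] := compact_EVT_min (ex_intro _ u1 Su1) Scpt
  (continuous_subspaceT (scalar_continuous fL)).
move: cS; rewrite inE => -[Kc c1].
exists (f c).
  by apply: fpos => //; rewrite -normr_eq0 c1 oner_eq0.
move=> u Ku; have [->|u0] := eqVneq u 0; first by rewrite normr0 mulr0 f0.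
have := cmin _ (mem_set (onS _ Ku u0)).
rewrite -[f (_ *: _)]/(F _) linearZ/=.
by rewrite ler_pdivlMl ?normr_gt0// mulrC.
Qed.

(** The linear term of a quadratic dominates for small [t]: this extracts the
    sign of a one-sided derivative at a minimum without differentiating. *)
Lemma ge0_first_order (R : realType) (a c : R) :
  (forall t, 0 < t <= 1 -> 0 <= 2 * t * a + t ^+ 2 * c) -> 0 <= a.
Proof.
move=> h; rewrite leNgt; apply/negP => a0.
(* This step is at most 1, and it keeps the quadratic term below half of the
   linear one since [t * |c| <= - a]. *)
pose t := - a / (`|c| - a).
have c0 := normr_ge0 c; have cc := ler_norm c.
have den0 : 0 < `|c| - a by lra.
have t0 : 0 < t by rewrite divr_gt0// oppr_gt0.
have t1 : t <= 1 by rewrite ler_pdivrMr//; lra.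
have tE : t * (`|c| - a) = - a by rewrite mulfVK// gt_eqF.
have := h t; rewrite t0 t1 => /(_ isT).
have -> : 2 * t * a + t ^+ 2 * c = t * (2 * a + t * c) by ring.
rewrite pmulr_rge0//.
have : t * c <= t * `|c| by rewrite ler_pM2l.
have : 0 <= t * (- a) by rewrite mulr_ge0 ?ltW// oppr_gt0.
by move: tE; rewrite mulrBr mulrN; lra.
Qed.

(** Farkas' lemma for a closed convex cone [K] and finitely many linear forms
    [L i].  The vector [x0], for which the combined form is positive on the
    nonzero part of [K], guarantees that the image of [K] is closed: it makes
    the sublevel sets in [K] of the squared distance [g] to [b] bounded.  At a
    minimizer, moving towards a point of [K] shows that the residual [r] is
    nonnegative on the image of [K], and shrinking the minimizer shows that
    [r] is nonpositive on its image, so that the hypothesis on [b] gives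
    [|r|^2 <= 0]. *)
Lemma conic_farkas (R : realType) n q (K : set 'rV[R]_n)
    (L : 'I_q -> 'rV[R]_n -> R) (b x0 : 'I_q -> R) :
  closed K -> (forall a u, 0 <= a -> K u -> K (a *: u)) ->
  (forall u v, K u -> K v -> K (u + v)) -> K 0 ->
  (forall i, scalar (L i)) ->
  (forall u, K u -> u != 0 -> 0 < \sum_i x0 i * L i u) ->
  (forall x : 'I_q -> R, (forall u, K u -> 0 <= \sum_i x i * L i u) ->
    0 <= \sum_i x i * b i) ->
  exists2 u, K u & forall i, L i u = b i.
Proof.
move=> Kcl KZ KD K0 LL x0pos bdual.
have LD i u v : L i (u + v) = L i u + L i v.
  by have := LL i 1 u v; rewrite scale1r mul1r.
have L0 i : L i 0 = 0.
  by apply: (addrI (L i 0)); rewrite -LD !addr0.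
have LZ i a u : L i (a *: u) = a * L i u.
  by have := LL i a u 0; rewrite !addr0 L0 addr0.
have LN i u : L i (- u) = - L i u.
  by apply: (addrI (L i u)); rewrite -LD !subrr L0.
pose g u := \sum_i (L i u - b i) ^+ 2.
have gcont : continuous g.
  apply: continuous_big => [|i _ u]; first exact: add_continuous.
  have rcvg : L i v - b i @[v --> nbhs u] --> L i u - b i.
    apply: (cvgB (F := nbhs u)); last exact: cvg_cst.
    exact: scalar_continuous.
  exact: (cvgM (F := nbhs u)).
pose h u := \sum_i x0 i * L i u.
have hL : scalar h.
  move=> a u v; rewrite /h mulr_sumr -big_split/=; apply: eq_bigr => i _.
  by rewrite LL; ring.
have [d d0 dh] := conic_coercive Kcl (fun a u a0 => KZ a u (ltW a0)) hL x0pos.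
pose S := K `&` [set u | g u <= g 0].
pose B := g 0 + \sum_i (x0 i ^+ 2 + x0 i * b i).
have Sbound u : S u -> `|u| <= B / d.
  case=> Ku /= gu; rewrite ler_pdivlMr// mulrC (le_trans (dh u Ku))//.
  rewrite (le_trans _ (lerD gu (lexx _)))// /h /g -big_split/=.
  apply: ler_sum => i _.
  (* The term [x0 i * (L i u - b i)] is at most the sum of the two squares. *)
  have := sqr_ge0 (L i u - b i - x0 i).
  by have := sqr_ge0 (L i u - b i); have := sqr_ge0 (x0 i); lra.
have Scpt : compact S.
  apply: bounded_closed_compact.
    exists (B / d); split; first exact: num_real.
    by move=> t Bt u /Sbound Su; exact: le_trans Su (ltW Bt).
  apply: closedI => //.
  apply: (@preimage_closed _ _ g [set t | t <= g 0]) => //; exact: closed_le.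
have S0 : S !=set0 by exists 0; split => //; exact: lexx.
have [u uS umin] := compact_EVT_min S0 Scpt
  (continuous_subspaceT gcont).
move: uS; rewrite inE => -[Ku /= gu].
have gmin v : K v -> g u <= g v.
  move=> Kv; have [gv|/ltW gv] := leP (g v) (g 0); last exact: le_trans gv.
  by apply: umin; rewrite inE.
pose r i := L i u - b i.
have step v : (forall t, 0 < t <= 1 -> K (u + t *: v)) ->
    0 <= \sum_i r i * L i v.
  move=> Kv; apply: (@ge0_first_order _ _ (\sum_i L i v ^+ 2)) => t t01.
  have := gmin _ (Kv t t01); rewrite -subr_ge0 /g -sumrB => /le_trans; apply.
  rewrite !mulr_sumr -big_split/=; apply: ler_sum => i _.
  by rewrite LD LZ /r le_eqVlt; apply/orP; left; apply/eqP; ring.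
have rdual v : K v -> 0 <= \sum_i r i * L i v.
  move=> Kv; apply: step => t /andP[t0 _]; apply: KD => //.
  by apply: KZ => //; exact: ltW.
have ru : \sum_i r i * L i u <= 0.
  rewrite -oppr_ge0 -sumrN.
  rewrite (eq_bigr (fun i => r i * L i (- u))); last first.
    by move=> i _; rewrite LN mulrN.
  apply: step => t /andP[t0 t1]; rewrite scalerN -{1}(scale1r u) -scalerBl.
  by apply: KZ => //; rewrite subr_ge0.
have r2 : \sum_i r i ^+ 2 <= 0.
  have := bdual r rdual.
  have -> : \sum_i r i * b i = \sum_i r i * L i u - \sum_i r i ^+ 2.
    by rewrite -sumrB; apply: eq_bigr => i _; rewrite /r; ring.
  by move=> ?; lra.
exists u => // i; apply/eqP; rewrite -subr_eq0 -sqrf_eq0.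
have /psumr_eq0P -> // : \sum_i r i ^+ 2 = 0.
  by apply/eqP; rewrite eq_le r2 sumr_ge0// => k _; exact: sqr_ge0.
by move=> k _; exact: sqr_ge0.
Qed.

(** * Positive semidefinite matrices and the trace pairing *)

Section PsdMatrices.
Local Open Scope sesquilinear_scope.
Variables (R : realType) (p : nat).
Implicit Types (A X : 'M[R[i]]_p) (v w : 'cV[R[i]]_p).

Lemma hermsymmxP A : reflect (A ^t* = A) (A \is hermsymmx).
Proof.
by apply: (iffP (is_hermitianmxP _ _ _)); rewrite expr0 scale1r => /esym.
Qed.

Lemma trC_mul m n k (A : 'M[R[i]]_(m, n)) (B : 'M[R[i]]_(n, k)) :
  (A *m B) ^t* = B ^t* *m A ^t*.
Proof. by rewrite trmx_mul map_mxM. Qed.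

Lemma herm_trace_real A X : A \is hermsymmx -> X \is hermsymmx ->
  \tr (A *m X) = (complex.Re (\tr (A *m X)))%:C.
Proof.
move=> /hermsymmxP hA /hermsymmxP hX; rewrite RRe_real//.
apply/CrealP.
by rewrite -trace_map_mx -mxtrace_tr map_trmx trC_mul hA hX mxtrace_mulC.
Qed.

(** Quadratic forms are trace pairings with rank-one matrices; this makes the
    semidefinite cone its own dual. *)
Lemma formE X v : (v ^t* *m X *m v) 0 0 = \tr (X *m (v *m v ^t*)).
Proof. by rewrite mulmxA mxtrace_mulC mulmxA trace_mx11. Qed.

Lemma dotC_ge0 v : 0 <= (v ^t* *m v) 0 0.
Proof.
rewrite mxE; apply: sumr_ge0 => i _; rewrite !mxE mulrC.
exact: mul_conjC_ge0.
Qed.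

Lemma dotC_gt0 v : v != 0 -> 0 < (v ^t* *m v) 0 0.
Proof.
move=> v0; rewrite lt_neqAle dotC_ge0 andbT eq_sym mxE.
apply: contra v0 => /eqP; under eq_bigr do rewrite !mxE mulrC.
move/psumr_eq0P => h; apply/eqP/colP => i; rewrite mxE; apply/eqP.
by rewrite -mul_conjC_eq0 h// => k _; exact: mul_conjC_ge0.
Qed.

Lemma hermsymmx_outer v : v *m v ^t* \is hermsymmx.
Proof. by apply/hermsymmxP; rewrite trC_mul trmxCK. Qed.

Lemma psdmx_outer v : psdmx (v *m v ^t*).
Proof.
split=> [|w]; first exact: hermsymmx_outer.
rewrite mulmxA -mulmxA -[v ^t* *m w]trmxCK trC_mul trmxCK.
move: (w ^t* *m v) => c; rewrite mxE big_ord1 !mxE.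
exact: mul_conjC_ge0.
Qed.

Lemma posdef_psd A : posdefmx A -> psdmx A.
Proof.
case=> hA Apos; split => // v; have [->|v0] := eqVneq v 0.
  by rewrite mulmx0 mxE.
exact/ltW/Apos.
Qed.

(** The columns of [P ^t*] are the eigenvectors when [P] diagonalizes a
    Hermitian matrix. *)
Lemma form_col A (P : 'M[R[i]]_p) k :
  ((col k (P ^t*)) ^t* *m A *m col k (P ^t*)) 0 0 = (P *m A *m P ^t*) k k.
Proof.
rewrite tr_col map_row trmxCK -row_mul mxE [RHS]mxE.
by apply: eq_bigr => j _; rewrite !mxE.
Qed.

Lemma psd_spectral X : psdmx X -> exists P : 'M[R[i]]_p, exists d : 'rV[R[i]]_p,
  [/\ P \is unitarymx, X = P ^t* *m diag_mx d *m P & forall k, 0 <= d 0 k].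
Proof.
case=> hX Xpsd; pose P := spectralmx X; pose d := spectral_diag X.
have Pu : P \is unitarymx := spectral_unitarymx X.
have XE : X = P ^t* *m diag_mx d *m P.
  by rewrite -invmx_unitary//; apply/orthomx_spectralP/hermitian_normalmx.
exists P, d; split=> // k; have := Xpsd (col k (P ^t*)).
rewrite form_col XE !mulmxA mulmxtVK// (unitarymxP Pu) mul1mx mxE eqxx.
by rewrite mulr1n.
Qed.

(** For unitary [P] this is the pairing of [A] with a diagonalized matrix: the
    sum of the values of the quadratic form of [A] at the eigenvectors, weighted
    by the eigenvalues. *)
Lemma trace_spectral A (P : 'M[R[i]]_p) (d : 'rV[R[i]]_p) :
  \tr (A *m (P ^t* *m diag_mx d *m P)) =
  \sum_k d 0 k * ((col k (P ^t*)) ^t* *m A *m col k (P ^t*)) 0 0.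
Proof.
rewrite mulmxA mxtrace_mulC !mulmxA mul_mx_diag.
by apply: eq_bigr => k _; rewrite mxE -form_col mulrC.
Qed.

Lemma trace_psd_ge0 A X : psdmx A -> psdmx X -> 0 <= \tr (A *m X).
Proof.
move=> [_ Apsd] /psd_spectral[P [d [_ -> d0]]]; rewrite trace_spectral.
by apply: sumr_ge0 => k _; rewrite mulr_ge0.
Qed.

(** The form of [A] is positive at every eigenvector of [X], so the pairing can
    vanish only if all eigenvalues of [X] do. *)
Lemma trace_posdef_gt0 A X : posdefmx A -> psdmx X -> X != 0 ->
  0 < \tr (A *m X).
Proof.
move=> Apos Xpsd X0; rewrite lt_neqAle trace_psd_ge0 ?andbT//; last first.
  exact: posdef_psd.
case: (psd_spectral Xpsd) X0 => P [d [Pu -> d0]].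
have Apos_col k : 0 < ((col k (P ^t*)) ^t* *m A *m col k (P ^t*)) 0 0.
  case: Apos => _; apply; apply/eqP => col0.
  have := form_col 1%:M P k; rewrite col0 mulmx0 mxE mulmx1 (unitarymxP Pu).
  by rewrite mxE eqxx => /esym/eqP; rewrite oner_eq0.
apply: contra; rewrite trace_spectral eq_sym => /eqP/psumr_eq0P h.
suff -> : d = 0 by rewrite raddf0 mulmx0 mul0mx.
apply/rowP => k; rewrite mxE; apply/eqP.
have /eqP : d 0 k * ((col k (P ^t*)) ^t* *m A *m col k (P ^t*)) 0 0 = 0.
  by apply: h => // j _; rewrite mulr_ge0// ltW.
by rewrite mulf_eq0 (gt_eqF (Apos_col k)) orbF.
Qed.

(** It suffices to test against the rank-one matrices [v v^*]. *)
Lemma psdmx_trace A : A \is hermsymmx ->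
  (forall X, psdmx X -> 0 <= complex.Re (\tr (A *m X))) -> psdmx A.
Proof.
move=> hA Atr; split=> // v.
rewrite formE herm_trace_real ?hermsymmx_outer// ler0c.
exact/Atr/psdmx_outer.
Qed.

Lemma psdmxD A X : psdmx A -> psdmx X -> psdmx (A + X).
Proof.
move=> [/hermsymmxP hA Ap] [/hermsymmxP hX Xp]; split=> [|v].
  by apply/hermsymmxP; rewrite linearD map_mxD hA hX.
by rewrite mulmxDr mulmxDl mxE addr_ge0.
Qed.

Lemma conjC_real (a : R) : Num.conj (a%:C : R[i]) = a%:C.
Proof. exact: conjc_real. Qed.

Lemma psdmxZ (a : R) X : 0 <= a -> psdmx X -> psdmx (a%:C *: X).
Proof.
move=> a0 [/hermsymmxP hX Xp]; split=> [|v].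
  apply/hermsymmxP; rewrite linearZ map_mxZ hX; congr (_ *: _).
  exact: conjC_real.
by rewrite -scalemxAr -scalemxAl mxE mulr_ge0// ler0c.
Qed.

Lemma psdmx0 : psdmx (0 : 'M[R[i]]_p).
Proof.
split=> [|v]; first by apply/hermsymmxP; rewrite linear0 map_mx0.
by rewrite mulmx0 mul0mx mxE.
Qed.

Lemma psdmx1 : psdmx (1%:M : 'M[R[i]]_p).
Proof.
split=> [|v]; first exact: hermitian1mx_subproof.
by rewrite mulmx1 dotC_ge0.
Qed.

Lemma posdef_shift (e : R) X : 0 < e -> psdmx X -> posdefmx (X + e%:C *: 1%:M).
Proof.
move=> e0 Xpsd; split=> [|v v0].
  by have [] := psdmxD Xpsd (psdmxZ (ltW e0) psdmx1).
rewrite mulmxDr mulmxDl mxE ltr_wpDl//; first by case: Xpsd.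
rewrite -scalemxAr -scalemxAl mulmx1 mxE mulr_gt0 ?ltcR//.
exact: dotC_gt0.
Qed.

(** Spelled out because the canonical scalars of complex matrices are
    complex. *)
Definition real_linear n (F : 'rV[R]_n -> 'M[R[i]]_p) :=
  forall (a : R) x y, F (a *: x + y) = a%:C *: F x + F y.

Lemma trace_scalar n (F : 'rV[R]_n -> 'M[R[i]]_p) A : real_linear F ->
  scalar (fun u => complex.Re (\tr (A *m F u))).
Proof.
move=> FL a x y; rewrite FL mulmxDr -scalemxAr linearD linearZ/=.
by rewrite raddfD; case: (\tr (A *m F x)) => s t /=; rewrite mul0r subr0.
Qed.

(** Each vector [v] contributes one closed condition on [u], a weak inequality
    for a real linear form. *)
Lemma psd_closed n (F : 'rV[R]_n -> 'M[R[i]]_p) : real_linear F ->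
  (forall u, F u \is hermsymmx) -> closed [set u | psdmx (F u)].
Proof.
move=> FL Fh.
have -> : [set u | psdmx (F u)] = \bigcap_(v : 'cV[R[i]]_p)
    ((fun u => complex.Re (\tr ((v *m v ^t*) *m F u))) @^-1` [set t | 0 <= t]).
  apply/seteqP; split=> u /=.
    move=> [_ Fu] v _ /=; have := Fu v.
    by rewrite formE mxtrace_mulC herm_trace_real ?ler0c// hermsymmx_outer.
  move=> Fu; split=> // v; have := Fu v I => /=.
  by rewrite formE mxtrace_mulC herm_trace_real ?ler0c// hermsymmx_outer.
apply: closed_bigI => v _; apply: preimage_closed; last exact: closed_ge.
by move=> u _; exact: (scalar_continuous (trace_scalar _ FL)).
Qed.

(** A real linear isomorphism from real coordinates onto the Hermitian matrices:
    with [U] the square real matrix of entries of [u], this is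
    [(U + U^T) + i (U - U^T)], and [U] is recovered from the value [X] as
    [(Re X + Im X) / 2].  It transports the compactness of real coordinate
    spaces to Hermitian matrices. *)
Definition herm_of (u : 'rV[R]_(p * p)) : 'M[R[i]]_p :=
  \matrix_(i, j)
    ((vec_mx u i j + vec_mx u j i) +i* (vec_mx u i j - vec_mx u j i)).

Lemma herm_of_linear : real_linear herm_of.
Proof.
move=> a x y; apply/matrixP => i j; rewrite !mxE /=.
by simpc; congr Complex; ring.
Qed.

Lemma herm_of_herm u : herm_of u \is hermsymmx.
Proof.
apply/hermsymmxP/matrixP => i j; rewrite !mxE /=.
by congr Complex; ring.
Qed.

Lemma herm_of_eq0 u : herm_of u = 0 -> u = 0.
Proof.
move=> /matrixP u0; apply: (can_inj (@vec_mxK _ p p)); rewrite linear0.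
apply/matrixP => i j; have /eqP := u0 i j.
rewrite !mxE eq_complex /= => /andP[/eqP h1 /eqP h2].
by move: h1 h2; rewrite ?mxE; lra.
Qed.

Lemma herm_of_surj X : X \is hermsymmx -> exists u, herm_of u = X.
Proof.
move=> /hermsymmxP/matrixP hX.
exists (mxvec (\matrix_(i, j) ((complex.Re (X i j) + complex.Im (X i j)) / 2))).
apply/matrixP => i j; rewrite /herm_of mxvecK !mxE.
rewrite -[X j i]hX !mxE; case: (X i j) => s t /=.
by congr Complex; field.
Qed.
End PsdMatrices.

(** * The image of the semidefinite cone *)

Section RealCombinations.
Variables (R : realType) (p q : nat) (C : 'I_q -> 'M[R[i]]_p).
Hypothesis C_sa : forall i, C i \is hermsymmx.
Implicit Types (x : 'rV[R]_q) (X : 'M[R[i]]_p).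

Lemma real_comb_linear : real_linear (real_comb C).
Proof.
move=> a x y; rewrite /real_comb scaler_sumr -big_split/=.
apply: eq_bigr => i _; rewrite scalerA -scalerDl; congr (_ *: _).
by rewrite !mxE rmorphD rmorphM.
Qed.

Lemma real_combZ a x : real_comb C (a *: x) = a%:C *: real_comb C x.
Proof.
rewrite /real_comb scaler_sumr; apply: eq_bigr => i _.
by rewrite mxE rmorphM scalerA.
Qed.

Lemma real_comb_herm x : real_comb C x \is hermsymmx.
Proof.
apply/hermsymmxP/matrixP => i j; rewrite /real_comb !mxE !summxE rmorph_sum.
apply: eq_bigr => k _; rewrite !mxE rmorphM; congr (_ * _).
  exact: conjC_real.
by have /hermsymmxP/matrixP/(_ i j) := C_sa k; rewrite !mxE.
Qed.

Lemma trace_real_comb x X :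
  \tr (real_comb C x *m X) = \sum_i (x 0 i)%:C * \tr (C i *m X).
Proof.
rewrite /real_comb mulmx_suml [\tr _]linear_sum; apply: eq_bigr => i _.
by rewrite -scalemxAl linearZ.
Qed.

Lemma Re_trace_real_comb x X :
  complex.Re (\tr (real_comb C x *m X)) =
  \sum_i complex.Re (\tr (C i *m X)) * x 0 i.
Proof.
have ReD : {morph @complex.Re R : a c / a + c} by move=> [? ?] [? ?].
rewrite trace_real_comb (big_morph _ ReD (erefl (complex.Re 0))).
apply: eq_bigr => i _; case: (\tr _) => s t /=.
by rewrite mul0r subr0 mulrC.
Qed.

Definition dual_cone (b : 'I_q -> R) :=
  forall x, psdmx (real_comb C x) -> 0 <= \sum_i b i * x 0 i.

Definition strict_dual_cone (b : 'I_q -> R) :=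
  forall x, x != 0 -> psdmx (real_comb C x) -> 0 < \sum_i b i * x 0 i.

Lemma trace_data (b : 'I_q -> R) X x : (forall i, \tr (C i *m X) = (b i)%:C) ->
  (\sum_i b i * x 0 i)%:C = \tr (real_comb C x *m X).
Proof.
move=> XC; rewrite trace_real_comb rmorph_sum; apply: eq_bigr => i _.
by rewrite XC rmorphM mulrC.
Qed.

Lemma psd_solution_dual (b : 'I_q -> R) X :
  psdmx X -> (forall i, \tr (C i *m X) = (b i)%:C) -> dual_cone b.
Proof.
by move=> Xpsd XC x xpsd; rewrite -ler0c (trace_data x XC) trace_psd_ge0.
Qed.

Lemma posdef_solution_dual (b : 'I_q -> R) X : real_independent C ->
  posdefmx X -> (forall i, \tr (C i *m X) = (b i)%:C) -> strict_dual_cone b.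
Proof.
move=> Cfree Xpos XC x x0 xpsd.
rewrite -ltcR (trace_data x XC) mxtrace_mulC trace_posdef_gt0//.
by apply: contra x0 => /eqP/Cfree ->.
Qed.

(** [conic_farkas] in the coordinates of [herm_of].  A vector [x] whose
    combination [real_comb C x] pairs nonnegatively with all positive
    semidefinite matrices makes that combination positive semidefinite, so the
    dual hypothesis on [b] applies to it. *)
Lemma psd_solution (b : 'I_q -> R) :
  (exists x, posdefmx (real_comb C x)) -> dual_cone b ->
  exists X, psdmx X /\ forall i, \tr (C i *m X) = (b i)%:C.
Proof.
move=> [x0 x0pos] bdual.
pose K := [set u | psdmx (herm_of u : 'M[R[i]]_p)].
pose L i u := complex.Re (\tr (C i *m herm_of u)).
have LE (x : 'I_q -> R) u : \sum_i x i * L i u =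
    complex.Re (\tr (real_comb C (\row_i x i) *m herm_of u)).
  by rewrite Re_trace_real_comb; apply: eq_bigr => i _; rewrite mxE mulrC.
have hL := @herm_of_linear R p.
have h0 : herm_of 0 = 0 :> 'M[R[i]]_p.
  by have := hL (-1) 0 0; rewrite scaler0 addr0 rmorphN1 scaleN1r addNr.
have hZ a u : herm_of (a *: u) = a%:C *: herm_of u :> 'M[R[i]]_p.
  by have := hL a u 0; rewrite h0 !addr0.
have hD u v : herm_of (u + v) = herm_of u + herm_of v :> 'M[R[i]]_p.
  by have := hL 1 u v; rewrite scale1r rmorph1 scale1r.
have [||||||| u Ku uL] := @conic_farkas R (p * p) q K L b (fun i => x0 0 i).
- exact: psd_closed hL (@herm_of_herm R p).
- by move=> a u a0 Ku; rewrite /K /= hZ; exact: psdmxZ.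
- by move=> u v Ku Kv; rewrite /K /= hD; exact: psdmxD.
- by rewrite /K /= h0; exact: psdmx0.
- by move=> i; exact: trace_scalar.
- move=> u Ku u0; rewrite LE -ltcR -herm_trace_real; last 2 first.
  + exact: real_comb_herm.
  + exact: herm_of_herm.
  apply: trace_posdef_gt0 => //; last first.
    by apply: contra u0 => /eqP/herm_of_eq0 ->.
  suff -> : \row_i x0 0 i = x0 by [].
  by apply/rowP => i; rewrite mxE.
- move=> x xK; rewrite (eq_bigr (fun i => b i * (\row_i x i) 0 i)).
    apply: bdual; apply: psdmx_trace; first exact: real_comb_herm.
    move=> X Xpsd; have [u uX] := herm_of_surj Xpsd.1.
    by rewrite -uX -LE; apply: xK; rewrite /K /= uX.
  by move=> i _; rewrite mxE mulrC.
exists (herm_of u); split=> // i.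
by rewrite -uL herm_trace_real// herm_of_herm.
Qed.

(** Strict positivity is uniform on the unit sphere by compactness; the margin
    [d] absorbs the perturbation in [posdef_solution] and bounds the infimum
    over the unit sphere of any norm. *)
Lemma strict_dual_margin (b : 'I_q -> R) : strict_dual_cone b ->
  exists2 d, 0 < d &
    forall x, psdmx (real_comb C x) -> d * `|x| <= \sum_i b i * x 0 i.
Proof.
move=> bpos.
apply: (@conic_coercive R q [set x | psdmx (real_comb C x)]).
- exact: psd_closed real_comb_linear real_comb_herm.
- by move=> a x a0 /= xpsd; rewrite real_combZ; apply: psdmxZ => //; exact: ltW.
- move=> a x y; rewrite mulr_sumr -big_split/=; apply: eq_bigr => i _.
  by rewrite !mxE; ring.
- by move=> x xpsd x0; exact: bpos.
Qed.

(** Adding [e] times the identity makes a positive semidefinite matrix positive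
    definite and moves its data by [e * tr (C i)], so that it suffices to solve
    for the data moved back by this amount. *)
Lemma posdef_solution (b : 'I_q -> R) :
  (exists x, posdefmx (real_comb C x)) -> strict_dual_cone b ->
  exists X, posdefmx X /\ forall i, \tr (C i *m X) = (b i)%:C.
Proof.
move=> Cpos /strict_dual_margin[d d0 db].
pose T x := complex.Re (\tr (real_comb C x *m 1%:M)).
have TE x : T x = \sum_i complex.Re (\tr (C i)) * x 0 i.
  rewrite /T Re_trace_real_comb; by apply: eq_bigr => i _; rewrite mulmx1.
have [||M M0 TM] := @seminorm_bounded R q (fun x => `|T x|).
- move=> x y; rewrite (le_trans _ (ler_normD _ _))// !TE -big_split/=.
  rewrite le_eqVlt; apply/orP; left; apply/eqP; congr `|_|.
  by apply: eq_bigr => i _; rewrite mxE mulrDr.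
- move=> a x; rewrite -normrM !TE mulr_sumr; congr `|_|.
  by apply: eq_bigr => i _; rewrite mxE mulrCA.
(* [e * |T x| <= d * |x|], so the perturbed data stay in the dual cone. *)
pose e := d / M; have e0 : 0 < e by rewrite divr_gt0.
have [||X [Xpsd XC]] :=
  @psd_solution (fun i => b i - e * complex.Re (\tr (C i))).
- exact: Cpos.
- move=> x xpsd; rewrite (eq_bigr (fun i => b i * x 0 i -
    e * (complex.Re (\tr (C i)) * x 0 i))); last by move=> i _; ring.
  rewrite sumrB -mulr_sumr -TE subr_ge0 (le_trans _ (db x xpsd))//.
  rewrite /e mulrAC ler_pdivrMr// -mulrA ler_pM2l// mulrC.
  exact: le_trans (ler_norm _) (TM x).
exists (X + e%:C *: 1%:M); split=> [|i]; first exact: posdef_shift.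
rewrite mulmxDr linearD/= XC -scalemxAr mulmx1 mxtraceZ.
have := herm_trace_real (C_sa i) (hermitian1mx_subproof _).
rewrite mulmx1 => trCi.
by rewrite [X in e%:C * X]trCi rmorphB rmorphM subrK.
Qed.
End RealCombinations.

Theorem proposition2p5 (R : realType) (p q : nat) (p_ge1 : (1 <= p)%N)
    (q_ge1 : (1 <= q)%N) (C : 'I_q -> 'M[R[i]]_p) (b : 'I_q -> R)
    (C_sa : forall i, C i \is hermsymmx)
    (C_indep : real_independent C)
    (C_pos : exists x : 'rV[R]_q, posdefmx (real_comb C x)) :
  (((exists X : 'M[R[i]]_p,
       psdmx X /\ forall i, \tr (C i *m X) = (b i)%:C)
    <->
    (forall x : 'rV[R]_q, psdmx (real_comb C x) -> 0 <= \sum_i b i * x 0 i))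
   /\
   ((forall x : 'rV[R]_q, psdmx (real_comb C x) -> 0 <= \sum_i b i * x 0 i)
    <->
    (0 <= ereal_inf [set (\sum_i b i * x 0 i)%R%:E |
                      x in [set x : 'rV[R]_q | psdmx (real_comb C x)]])%E))
  /\
  (((exists X : 'M[R[i]]_p,
       posdefmx X /\ forall i, \tr (C i *m X) = (b i)%:C)
    <->
    (forall x : 'rV[R]_q, x != 0 -> psdmx (real_comb C x) ->
       0 < \sum_i b i * x 0 i))
   /\
   (forall N : 'rV[R]_q -> R, is_norm N ->
    ((forall x : 'rV[R]_q, x != 0 -> psdmx (real_comb C x) ->
        0 < \sum_i b i * x 0 i)
     <->
     (0 < ereal_inf [set (\sum_i b i * x 0 i)%R%:E |
                      x in [set x : 'rV[R]_q |
                             psdmx (real_comb C x) /\ N x = 1%R]])%E))).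
Proof.
split; split.
- split; last exact: psd_solution.
  by move=> [X [Xpsd XC]]; exact: psd_solution_dual Xpsd XC.
- split=> [bdual|inf_ge0 x xpsd].
    by apply/ereal_infP => _ [x xpsd <-]; rewrite lee_fin bdual.
  rewrite -lee_fin (le_trans inf_ge0)//; apply: ereal_inf_lbound.
  by exists x.
- split; last exact: posdef_solution.
  by move=> [X [Xpos XC]]; exact: posdef_solution_dual Xpos XC.
move=> N [ND NZ N0eq]; split=> [bpos|inf_gt0 x x0 xpsd].
  have [d d0 db] := strict_dual_margin C_sa bpos.
  have [M M0 NM] := seminorm_bounded ND NZ.
  apply: (@lt_le_trans _ _ (d / M)%:E); first by rewrite lte_fin divr_gt0.
  apply/ereal_infP => _ [x [xpsd Nx] <-]; rewrite lee_fin.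
  rewrite (le_trans _ (db x xpsd))// ler_pM2l// -div1r ler_pdivrMr// mulrC.
  by rewrite -Nx.
(* The strict inequality is homogeneous, so it can be tested at [x / N x]. *)
have Nx0 : 0 < N x.
  rewrite lt_neqAle; apply/andP; split.
    by apply: contra x0; rewrite eq_sym => /eqP/N0eq ->.
  have NN : N (- x) = N x by rewrite -scaleN1r NZ normrN1 mul1r.
  have := ND x (- x); rewrite subrr NN -mulr2n.
  by rewrite -(scale0r 0) NZ normr0 mul0r pmulrn_lge0.
have : 0 < \sum_i b i * ((N x)^-1 *: x) 0 i.
  rewrite -lte_fin (lt_le_trans inf_gt0)//; apply: ereal_inf_lbound.
  exists ((N x)^-1 *: x) => //; split; last first.
    by rewrite NZ gtr0_norm ?invr_gt0// mulVf// gt_eqF.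
  by rewrite real_combZ; apply: psdmxZ => //; rewrite invr_ge0 ltW.
rewrite (eq_bigr (fun i => (N x)^-1 * (b i * x 0 i))); last first.
  by move=> i _; rewrite mxE mulrCA.
by rewrite -mulr_sumr pmulr_rgt0// invr_gt0.
Qed.
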